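(* Let $p$, $q$, $r$ be three distinct primes, fixed. For each $\varepsilon>0$ there is $a_\varepsilon$ such that for every exponent $a\ge a_\varepsilon$ there exist exponents $b$ and $c$ (with $q^b, r^c>2$) such that \[ \mathcal{A}_{\{p^a,q^b,r^c\}}\supset\{\,n\in\mathbb{Z} : |n|\le (\tfrac14-\varepsilon)p^a\,\}. \]
   Context: For pairwise coprime positive integers $P,Q,R>2$, the ternary inclusion-exclusion polynomial \[ Q_{\{P,Q,R\}}(x)=\frac{(x^{PQR}-1)(x^P-1)(x^Q-1)(x^R-1)}{(x^{PQ}-1)(x^{QR}-1)(x^{RP}-1)(x-1)} \] is a polynomial with integer coefficients, and $\mathcal{A}_{\{P,Q,R\}}$ denotes the set of its coefficients. When $P=p^a$, $Q=q^b$, $R=r^c$ are powers of three distinct primes (each $>2$), this polynomial is called a unitary cyclotomic polynomial of order three, denoted $\Phi^*_{p^aq^br^c}(x)$. *)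

(* Defs.v *)
From mathcomp Require Import all_boot all_order all_algebra.
From mathcomp Require Import boolp classical_sets reals.

Set Implicit Arguments.
Unset Strict Implicit.
Unset Printing Implicit Defensive.

Import Order.TTheory GRing.Theory Num.Theory.
Local Open Scope ring_scope.
Local Open Scope classical_set_scope.

(* The denominator is monic, so [%/] on {poly int} is Euclidean division with
   no scaling of the dividend; for pairwise coprime P, Q, R > 0 it is exact. *)
Definition incl_excl_poly (P Q R : nat) : {poly int} :=
  (('X^(P * Q * R) - 1) * ('X^P - 1) * ('X^Q - 1) * ('X^R - 1))
  %/ (('X^(P * Q) - 1) * ('X^(Q * R) - 1) * ('X^(R * P) - 1) * ('X - 1)).

(* Only the coefficients of degree at most deg are listed in the underlying
   sequence, so 0 belongs to this set only if it occurs among them. *)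
Definition coef_set (P Q R : nat) : set int :=
  [set n | n \in (incl_excl_poly P Q R : seq int)].

(* Main.v *)
Require Import Defs.
From mathcomp Require Import all_boot all_order all_algebra.
From mathcomp Require Import cyclic.
From mathcomp Require Import boolp classical_sets reals.
From mathcomp Require Import zify ring lra.

(** Write P = p^a, Q = q^b, R = r^c and F for the inclusion-exclusion
    polynomial.  If mu P + lam Q = PQ + 1, the binary polynomial
    (t^PQ - 1)(t - 1) / ((t^P - 1)(t^Q - 1)) equals
      b(t) = sum_(x < mu, y < lam) t^(xP + yQ)
             - t sum_(x < Q - mu, y < P - lam) t^(xP + yQ),
    and F(X) (X^PQ - 1) = (1 + X + ... + X^(P-1)) (X^Q - 1) b(X^R).  Hence, with
    G = b(X^R) / (1 - X^PQ),
      F_n = sum_(k < P) (G_(n-k) - G_(n-k-Q)).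

    Powers of an integer congruent to 1 mod p^2 fill a whole class 1 mod p^s,
    with s independent of a.  So, for h = floor(p/2) p^(a-1), one can choose the
    exponents such that Q = 1 - h and R = 1 + h mod P, while R P d = 1 mod Q for
    some d bounded independently of b.  Take lam = 1 + h.  A monomial
    X^(R(xP + yQ)) of b(X^R) contributes to G_t only if y = t mod P and
    x = d t mod Q, and the latter is very close to 0 or to Q when t mod Q is.
    For t in the window just below R lam Q, this gives G_t = [t mod P < lam] if
    t mod Q < P, and G_t = 0 if t mod Q >= Q - P.  For n in this window with
    n = m - 1 mod Q only the m terms k < m survive, and each of them is 1 when
    n = h mod P, and -1 when n = -1 mod P, as long as m < h.  Finally
    h >= P/3 > P/4. *)

Set Implicit Arguments.
Unset Strict Implicit.
Unset Printing Implicit Defensive.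

(** * Powers of an integer congruent to 1 modulo a prime power *)

Lemma expn1D_second_order y n : exists z, (1 + y) ^ n = 1 + n * y + y ^ 2 * z.
Proof.
elim: n => [|n [z IHn]]; first by exists 0; rewrite expn0; lia.
by exists (n + z + y * z); rewrite expnSr IHn mulnDr muln1 -!mulnn; ring.
Qed.

(** Each p-th power raises the valuation of the difference to 1 by exactly one: as s >= 2, the
    second-order term is divisible by [p ^ (s + i + 2)], also for p = 2. *)
Lemma expn_prime_power p s u i : prime p -> 2 <= s -> ~~ (p %| u) ->
  exists2 w, ~~ (p %| w) & (1 + p ^ s * u) ^ (p ^ i) = 1 + p ^ (s + i) * w.
Proof.
move=> p_pr s_ge2 pNu; elim: i => [|i [w pNw IHi]].
  by exists u; rewrite // expn0 expn1 addn0.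
have [z Ez] := expn1D_second_order (p ^ (s + i) * w) p.
exists (w + p * (p ^ (s + i - 2) * w ^ 2 * z)).
  by rewrite dvdn_addl // dvdn_mulr.
rewrite expnSr expnM IHi Ez.
have E : p ^ (s + i) = p * (p * p ^ (s + i - 2)).
  by rewrite -!expnS; congr (_ ^ _); clear -s_ge2; lia.
by rewrite addnS (expnS _ (s + i)) E -!mulnn; ring.
Qed.

Lemma coprime_inv_mod c m : coprime c m -> exists j, c * j = 1 %[mod m].
Proof.
move=> cop; exists (chinese c m 0 1 %/ c).
have dv : c %| chinese c m 0 1 by rewrite /dvdn chinese_modl // mod0n.
by rewrite mulnC divnK // chinese_modr.
Qed.

(** Hensel-style lifting: adding a multiple of [p ^ i] to the exponent keeps the residue modulo [M]
    and shifts the next p-adic digit by any prescribed amount. *)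
Lemma expn_hits_residue p s u i v : prime p -> 2 <= s -> ~~ (p %| u) ->
  v = 1 %[mod p ^ s] -> exists e, (1 + p ^ s * u) ^ e = v %[mod p ^ (s + i)].
Proof.
move=> p_pr s_ge2 pNu v1; elim: i => [|i [e IHi]].
  by exists 0; rewrite addn0 expn0.
set g := 1 + p ^ s * u in IHi *; set M := p ^ (s + i) in IHi *.
have [w pNw Ew] := expn_prime_power i p_pr s_ge2 pNu.
have p_gt0 := prime_gt0 p_pr.
have EMp : p ^ (s + i.+1) = M * p by rewrite addnS expnSr.
(* The multiple of [M * p] added to [v] keeps the defect [M * t] a natural number. *)
have [t Et] : exists t, v + M * p * g ^ e = g ^ e + M * t.
  have le_gv : g ^ e <= v + M * p * g ^ e.
    by apply: leq_trans (leq_addl _ _); rewrite leq_pmull // muln_gt0 expn_gt0 p_gt0.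
  have : M %| v + M * p * g ^ e - g ^ e.
    by rewrite -eqn_mod_dvd // -mulnA addnC mulnC modnMDl IHi.
  by case/dvdnP=> t Et; exists t; rewrite [M * t]mulnC -Et subnKC.
have cop : coprime (g ^ e * w) p.
  rewrite coprimeMl coprime_sym [coprime w _]coprime_sym !prime_coprime // pNw andbT.
  rewrite Euclid_dvdX // negb_and /g -(ltn_predK s_ge2) expnS -mulnA.
  by rewrite dvdn_addl ?dvdn_mulr // dvdn1 neq_ltn prime_gt1 ?orbT.
have [j Ej] := coprime_inv_mod cop.
(* [j] inverts [g ^ e * w] modulo p, so to first order this factor adds exactly [M * t]. *)
exists (e + p ^ i * (j * t)).
rewrite expnD expnM Ew EMp.
have [z ->] := expn1D_second_order (M * w) (j * t).
have -> : v %% (M * p) = (g ^ e + M * t) %% (M * p).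
  by rewrite -Et addnC [_ * g ^ e]mulnC modnMDl.
apply/eqP.
have [y Ey] : exists y, M = p * y.
  by exists (p ^ (s + i).-1); rewrite -expnS /M; congr (_ ^ _); clear -s_ge2; lia.
have -> : g ^ e * (1 + j * t * (M * w) + (M * w) ^ 2 * z) =
   g ^ e * w ^ 2 * y * z * (M * p) + (g ^ e + M * (g ^ e * w * j * t)).
  by rewrite -!mulnn {3}Ey; ring.
rewrite modnMDl eqn_modDl -!muln_modr eqn_pmul2l ?expn_gt0 ?p_gt0 //.
by rewrite -modnMml Ej modnMml mul1n.
Qed.

(** The valuation of g - 1 serves as [k] for all [a] at once. Since [g ^ (p ^ a)] is 1 modulo
    [p ^ a], only [e] modulo [p ^ a] matters; this leaves freedom to enlarge exponents and to impose
    conditions at another prime. *)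
Lemma expn_dense p g : prime p -> 1 < g -> g = 1 %[mod p ^ 2] ->
  exists k, forall a v, v = 1 %[mod p ^ k] ->
    exists e, forall e', e' = e %[mod p ^ a] -> g ^ e' = v %[mod p ^ a].
Proof.
move=> p_pr g_gt1 g1; have p_gt0 := prime_gt0 p_pr.
have g1_gt0 : 0 < g - 1 by lia.
set s := logn p (g - 1).
have s_ge2 : 2 <= s.
  by rewrite -pfactor_dvdn // -eqn_mod_dvd; [apply/eqP | lia].
have [u cop Eu] := pfactor_coprime p_pr g1_gt0.
have pNu : ~~ (p %| u) by rewrite -prime_coprime.
have Eg : g = 1 + p ^ s * u by rewrite mulnC -Eu; lia.
exists s => a v v1; have [e Ee] := expn_hits_residue a p_pr s_ge2 pNu v1.
rewrite -Eg in Ee.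
have dvd_a : p ^ a %| p ^ (s + a) by rewrite dvdn_exp2l // leq_addl.
have period x : g ^ (x + p ^ a) = g ^ x %[mod p ^ a].
  have [w _] := expn_prime_power a p_pr s_ge2 pNu; rewrite -Eg => Ew; rewrite expnD Ew.
  have [c ->] := dvdnP dvd_a.
  by rewrite -modnMmr addnC mulnAC modnMDl modnMmr muln1.
have periodM x y : g ^ (x + y * p ^ a) = g ^ x %[mod p ^ a].
  by elim: y => [|y IHy]; rewrite ?addn0 // mulSn addnCA addnC period.
exists e => e' Ee'.
rewrite -[RHS](modn_dvdm _ dvd_a) -Ee modn_dvdm //.
rewrite (divn_eq e' (p ^ a)) (divn_eq e (p ^ a)) ![_ * _ + _]addnC !periodM.
by rewrite Ee'.
Qed.

(** * Choice of the exponents b and c *)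

Lemma coprime_primes p q : prime p -> prime q -> p <> q -> coprime p q.
Proof. by move=> p_pr q_pr /eqP ne; rewrite prime_coprime // dvdn_prime2. Qed.

Lemma crt_window P Q x y lo : 0 < P -> 0 < Q -> coprime P Q ->
  exists n, [/\ lo <= n, n < lo + P * Q, n = x %[mod P] & n = y %[mod Q]].
Proof.
move=> P_gt0 Q_gt0 cop; have PQ_gt0 : 0 < P * Q by rewrite muln_gt0 P_gt0.
set z := chinese P Q x y + lo * (P * Q).
have le_lo : lo <= z by rewrite (leq_trans _ (leq_addl _ _)) // leq_pmulr.
exists (lo + (z - lo) %% (P * Q)).
have Ez : lo + (z - lo) %% (P * Q) = chinese P Q x y %[mod P * Q].
  by rewrite modnDmr subnKC // /z addnC modnMDl.
split; first exact: leq_addr.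
- by rewrite ltn_add2l ltn_pmod.
- rewrite -(modn_dvdm _ (dvdn_mulr Q (dvdnn P))) Ez modn_dvdm ?dvdn_mulr //.
  by rewrite chinese_modl.
rewrite -(modn_dvdm _ (dvdn_mull P (dvdnn Q))) Ez modn_dvdm ?dvdn_mull //.
by rewrite chinese_modr.
Qed.

(** The order of choices matters: [d] inverts P only modulo a fixed power of q, hence is bounded
    before b is chosen; then b is taken large, and finally c, so that R inverts [P * d] modulo the
    whole of Q. *)
Lemma prime_power_residues p q r :
  prime p -> prime q -> prime r -> p <> q -> q <> r -> r <> p ->
  exists k, forall a u v, u = 1 %[mod p ^ k] -> v = 1 %[mod p ^ k] ->
  exists b c d, [/\ 0 < d, q ^ b = u %[mod p ^ a], r ^ c = v %[mod p ^ a],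
    r ^ c * p ^ a * d = 1 %[mod q ^ b] &
    2 * d * (p ^ a) ^ 2 < q ^ b /\ 4 * p ^ a * q ^ b <= r ^ c].
Proof.
move=> p_pr q_pr r_pr pq qr rp.
have cop_qp : coprime q p by rewrite coprime_sym coprime_primes.
have cop_rp : coprime r p by rewrite coprime_primes.
have cop_rq : coprime r q by rewrite coprime_sym coprime_primes.
have p_gt0 := prime_gt0 p_pr; have q_gt0 := prime_gt0 q_pr; have r_gt0 := prime_gt0 r_pr.
set L := totient (p ^ 2); set L' := L * totient (q ^ 2).
have L_gt0 : 0 < L by rewrite totient_gt0 expn_gt0 p_gt0.
have L'_gt0 : 0 < L' by rewrite muln_gt0 L_gt0 totient_gt0 expn_gt0 q_gt0.
have gt1 g l : prime g -> 0 < l -> 1 < g ^ l.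
  by move=> g_pr l_gt0; rewrite -(exp1n l) ltn_exp2r // prime_gt1.
have [k1 H1] : exists k, forall a v, v = 1 %[mod p ^ k] -> exists e, forall e',
    e' = e %[mod p ^ a] -> (q ^ L) ^ e' = v %[mod p ^ a].
  by apply: expn_dense; rewrite ?gt1 // Euler_exp_totient // coprimeXr.
have [k2 H2] : exists k, forall a v, v = 1 %[mod p ^ k] -> exists e, forall e',
    e' = e %[mod p ^ a] -> (r ^ L') ^ e' = v %[mod p ^ a].
  apply: expn_dense; rewrite ?gt1 //.
  by rewrite expnM -modnXm Euler_exp_totient ?coprimeXr // modnXm exp1n.
have [k H] : exists k, forall a v, v = 1 %[mod q ^ k] -> exists e, forall e',
    e' = e %[mod q ^ a] -> (r ^ L') ^ e' = v %[mod q ^ a].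
  apply: expn_dense; rewrite ?gt1 //.
  by rewrite /L' mulnC expnM -modnXm Euler_exp_totient ?coprimeXr // modnXm exp1n.
have [k3 k3_gt0 H3] : exists2 k, 0 < k & forall a v, v = 1 %[mod q ^ k] ->
    exists e, forall e', e' = e %[mod q ^ a] -> (r ^ L') ^ e' = v %[mod q ^ a].
  exists k.+1 => // a v v1; apply: H; have dv : q ^ k %| q ^ k.+1 by rewrite dvdn_exp2l.
  by rewrite -(modn_dvdm _ dv) v1 modn_dvdm.
exists (maxn k1 k2) => a u v u1 v1.
have [e1 He1] : exists e, forall e', e' = e %[mod p ^ a] -> (q ^ L) ^ e' = u %[mod p ^ a].
  have dv : p ^ k1 %| p ^ maxn k1 k2 by rewrite dvdn_exp2l // leq_maxl.
  by apply: H1; rewrite -(modn_dvdm _ dv) u1 modn_dvdm.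
have [e2 He2] : exists e, forall e', e' = e %[mod p ^ a] -> (r ^ L') ^ e' = v %[mod p ^ a].
  have dv : p ^ k2 %| p ^ maxn k1 k2 by rewrite dvdn_exp2l // leq_maxr.
  by apply: H2; rewrite -(modn_dvdm _ dv) v1 modn_dvdm.
set P := p ^ a in He1 He2 *.
have P_gt0 : 0 < P by rewrite expn_gt0 p_gt0.
set D := q ^ k3.
have D_gt0 : 0 < D by rewrite expn_gt0 q_gt0.
have [d0 Ed0] : exists j, P * j = 1 %[mod D].
  by apply: coprime_inv_mod; rewrite coprimeXl // coprimeXr // coprime_sym.
(* The summand [D] makes [d] positive. *)
set d := d0 %% D + D.
have Ed : P * d = 1 %[mod D] by rewrite /d -modnMmr modnDr modn_mod modnMmr.
have d_gt0 : 0 < d by rewrite addn_gt0 D_gt0 orbT.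
have d_le : d <= 2 * D by rewrite mul2n -addnn leq_add2r ltnW // ltn_pmod.
(* The added multiple of P preserves the residue of Q modulo P and makes Q large. *)
pose b := L * (e1 + (4 * D * P ^ 2) * P).
have b_ge : 4 * D * P ^ 2 <= b.
  rewrite /b; apply: (@leq_trans (4 * D * P ^ 2 * P)); first by rewrite leq_pmulr.
  by apply: leq_trans (leq_addl e1 _) _; rewrite leq_pmull.
have b_lt : b < q ^ b by rewrite ltn_expl // prime_gt1.
have k3_le : k3 <= b.
  apply: leq_trans b_ge; apply: (@leq_trans D); first by rewrite ltnW // ltn_expl // prime_gt1.
  by rewrite mulnAC leq_pmull // muln_gt0 expn_gt0 P_gt0.
set Q := q ^ b in b_lt *.
have Q_gt0 : 0 < Q by rewrite expn_gt0 q_gt0.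
have D_Q : D %| Q by rewrite dvdn_exp2l.
have cop_PdQ : coprime (P * d) Q.
  have : coprime (P * d) q.
    by rewrite -(@coprime_pexpr k3) // -/D -coprime_modl Ed coprime_modl coprime1n.
  by move=> ?; rewrite coprimeXr.
have [w Ew] := coprime_inv_mod cop_PdQ.
(* [w], the inverse of [P * d] modulo Q, lies in the class that powers of [r ^ L'] fill. *)
have w1 : w = 1 %[mod D].
  by rewrite -[w]mul1n -modnMml -Ed modnMml -(modn_dvdm _ D_Q) Ew modn_dvdm.
have [e3 He3] := H3 b w w1.
have cop_PQ : coprime P Q by rewrite coprimeXl // coprimeXr // coprime_sym.
(* The conditions on R modulo P and modulo Q depend on [e] modulo P and modulo Q respectively; the
   last summand makes R large. *)
pose e := chinese P Q e2 e3 + (4 * P * Q) * (P * Q).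
exists b, (L' * e), d; rewrite -/P -/Q; split=> //.
- by rewrite /Q /b expnM; apply: He1; rewrite addnC modnMDl.
- rewrite expnM; apply: He2.
  by rewrite /e addnC mulnCA mulnC modnMDl chinese_modl.
- have Er : r ^ (L' * e) = w %[mod Q].
    by rewrite expnM; apply: He3; rewrite /e addnC mulnA modnMDl chinese_modr.
  by rewrite -mulnA -modnMml Er modnMml mulnC.
split.
  apply: leq_ltn_trans b_lt; apply: leq_trans b_ge.
  by rewrite leq_mul2r; apply/orP; right; rewrite -[4]/(2 * 2) -mulnA leq_mul2l.
apply: (@leq_trans (L' * e)); last by rewrite ltnW // ltn_expl // prime_gt1.
apply: (@leq_trans e); last by rewrite leq_pmull.
by apply: leq_trans (leq_addl _ _); rewrite leq_pmulr // muln_gt0 P_gt0.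
Qed.

Lemma modn_eq_of_shift P a u v s : s < P -> a + u * P = v * P + s -> a %% P = s.
Proof. by move=> lt_s E; rewrite -(modnMDl u) addnC E modnMDl modn_small. Qed.

(** [h] is P / 2 rounded down to a multiple of [p ^ a.-1]; the ratio h / P is smallest, namely 1/3,
    at p = 3. *)
Lemma half_power_bounds p a : prime p -> (3 < a) ->
  let h := ((p %/ 2) * p ^ a.-1) in
  [/\ (2 * h <= p ^ a), (p ^ a <= 3 * h) & (12 <= p ^ a)].
Proof.
move=> p_pr a_gt3 h; have p_gt1 := prime_gt1 p_pr.
have EP : (p ^ a = p * p ^ a.-1) by rewrite -expnS prednK // (ltn_trans _ a_gt3).
rewrite /h EP !mulnA !leq_mul2r; split.
- by apply/orP; right; move: (p) => x; clear; lia.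
- by apply/orP; right; move: p_gt1; move: (p) => x; clear; lia.
rewrite -EP (leq_trans (isT : (12 <= 2 ^ 4))) //.
by apply: (@leq_trans (p ^ 4)); rewrite ?leq_exp2r // leq_exp2l.
Qed.

Import Order.TTheory GRing.Theory Num.Theory.
Local Open Scope ring_scope.
Local Open Scope classical_set_scope.

(** * The binary polynomial and the division by X^PQ - 1 *)

Definition geom (n : nat) (t : {poly int}) : {poly int} := \sum_(i < n) t ^+ i.

Lemma geomE n t : (t - 1) * geom n t = t ^+ n - 1.
Proof. by rewrite subrX1. Qed.

Definition binary_poly (P Q lam mu : nat) (t : {poly int}) : {poly int} :=
  geom mu (t ^+ P) * geom lam (t ^+ Q)
  - t * (geom (Q - mu) (t ^+ P) * geom (P - lam) (t ^+ Q)).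

(** The geometric sums telescope, and the Bezout relation makes the exponents match: P (Q - mu) + 1
    = Q lam and Q (P - lam) + 1 = P mu. *)
Lemma binary_polyE P Q lam mu t : (mu * P + lam * Q = (P * Q).+1)%N ->
  (mu <= Q)%N -> (lam <= P)%N ->
  (t ^+ P - 1) * (t ^+ Q - 1) * binary_poly P Q lam mu t =
  (t ^+ (P * Q) - 1) * (t - 1).
Proof.
move=> bez le_mu le_lam.
have E1 : t * t ^+ (P * (Q - mu)) = t ^+ (Q * lam).
  by rewrite -exprS; congr (_ ^+ _); rewrite mulnBr; nia.
have E2 : t * t ^+ (Q * (P - lam)) = t ^+ (P * mu).
  by rewrite -exprS; congr (_ ^+ _); rewrite mulnBr; nia.
have E3 : t ^+ (P * mu) * t ^+ (P * (Q - mu)) = t ^+ (P * Q).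
  by rewrite -exprD -mulnDr subnKC.
transitivity ((t ^+ (P * mu) - 1) * (t ^+ (Q * lam) - 1)
  - t * ((t ^+ (P * (Q - mu)) - 1) * (t ^+ (Q * (P - lam)) - 1))).
  by rewrite !exprM -!geomE /binary_poly; ring.
move: E1 E2 E3; set a := t ^+ (P * mu); set c := t ^+ (P * (Q - mu)).
set d := t ^+ (Q * (P - lam)) => <- <- <-.
ring.
Qed.

Definition polydvd (d s : {poly int}) := exists c, s = c * d.

Lemma polydvd_mull c d s : polydvd d s -> polydvd d (c * s).
Proof. by case=> e ->; exists (c * e); rewrite mulrA. Qed.

Lemma polydvdD d s s' : polydvd d s -> polydvd d s' -> polydvd d (s + s').
Proof. by case=> e -> [e' ->]; exists (e + e'); rewrite mulrDl. Qed.

Lemma polydvd_sum d n (f : 'I_n -> {poly int}) :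
  (forall i, polydvd d (f i)) -> polydvd d (\sum_(i < n) f i).
Proof.
move=> df; elim/big_ind: _ => [|x y|i _]; [|exact: polydvdD|exact: df].
by exists 0; rewrite mul0r.
Qed.

Lemma polydvd_expr_mod t M i j : i = j %[mod M] ->
  polydvd (t ^+ M - 1) (t ^+ i - t ^+ j).
Proof.
wlog le_ji : i j / (j <= i)%N.
  move=> IH ij; case/orP: (leq_total j i) => le; first exact: IH.
  have -> : t ^+ i - t ^+ j = -1 * (t ^+ j - t ^+ i) by ring.
  apply: polydvd_mull; exact: IH.
move/eqP; rewrite eqn_mod_dvd // => /dvdnP[k Ek].
exists (t ^+ j * geom k (t ^+ M)).
by rewrite -mulrA [geom _ _ * _]mulrC geomE -exprM mulrBr mulr1 -exprD mulnC -Ek subnKC.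
Qed.

(* Modulo t^P - 1 the exponents R k run over all residues, so the geometric sum
   of t^R reduces to that of t. *)
Lemma geom_dvd_geom_expr P R t : (0 < P)%N -> coprime R P ->
  polydvd (geom P t) (geom P (t ^+ R)).
Proof.
case: P => // P _ cop.
pose f (i : 'I_P.+1) : 'I_P.+1 := inord (R * i %% P.+1).
have fE i : f i = (R * i %% P.+1)%N :> nat by rewrite inordK // ltn_pmod.
have f_inj : injective f.
  move=> i j /(congr1 val) /=; rewrite !fE => /eqP.
  wlog le_ji : i j / (j <= i)%N.
    move=> IH ij; case/orP: (leq_total j i) => le; first exact: IH.
    by apply/esym; apply: IH => //; rewrite eq_sym.
  rewrite eqn_mod_dvd ?leq_mul2l ?le_ji ?orbT // -mulnBr Gauss_dvdr 1?coprime_sym //.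
  move/dvdn_leq => H; apply/val_inj/eqP; rewrite /= eqn_leq le_ji andbT leqNgt.
  apply/negP => lt_ji; have := H; rewrite subn_gt0 => /(_ lt_ji).
  by have := ltn_ord i; lia.
have -> : geom P.+1 (t ^+ R) = geom P.+1 t
    + \sum_(i < P.+1) (t ^+ (R * i) - t ^+ (f i)).
  rewrite sumrB /geom [X in X + _](reindex_inj f_inj) /= addrC subrK.
  by apply: eq_bigr => i _; rewrite exprM.
apply: polydvdD; first by exists 1; rewrite mul1r.
have [|c ->] := @polydvd_sum (t ^+ P.+1 - 1) _ (fun i => t ^+ (R * i) - t ^+ (f i)).
  by move=> i; apply: polydvd_expr_mod; rewrite fE modn_mod.
by apply: polydvd_mull; exists (t - 1); rewrite geomE.
Qed.

(** With t = X^R and S inverse to R modulo PQ, X is t^S modulo [Z]. So the first two factors become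
    a multiple of [geom P t * (t ^+ Q - 1)], whose product with [b] is t^PQ - 1, a multiple of
    [Z]. *)
Lemma incl_excl_quotient P Q R lam mu : (0 < P)%N -> (0 < Q)%N -> (0 < R)%N ->
  coprime R (P * Q) -> (mu * P + lam * Q = (P * Q).+1)%N ->
  (mu <= Q)%N -> (lam <= P)%N ->
  polydvd ('X^(P * Q) - 1) (geom P 'X * ('X^Q - 1) * binary_poly P Q lam mu 'X^R).
Proof.
move=> P_gt0 Q_gt0 R_gt0 cop bez le_mu le_lam; set Z := 'X^(P * Q) - 1.
have [S RS1] : exists S, (R * S = 1 %[mod P * Q])%N by exact: coprime_inv_mod.
have copS : coprime S P.
  have : coprime (R * S) (P * Q) by rewrite -coprime_modl RS1 coprime_modl coprime1n.
  by rewrite coprimeMl !coprimeMr => /and3P[_ ? _].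
set t : {poly int} := 'X^R; set b := binary_poly _ _ _ _ _.
have X_t i : polydvd Z ('X^i - t ^+ (S * i)).
  rewrite /t -exprM mulnA; apply: polydvd_expr_mod.
  by rewrite -[RHS]modnMml RS1 modnMml mul1n.
have [c1 E1] : polydvd Z (geom P 'X - geom P (t ^+ S)).
  rewrite /geom -sumrB; apply: polydvd_sum => i; rewrite -exprM; exact: X_t.
have [c2 E2] := geom_dvd_geom_expr t P_gt0 copS.
have [c3 E3] := X_t Q.
have E4 : t ^+ (S * Q) - 1 = (t ^+ Q - 1) * geom S (t ^+ Q).
  by rewrite geomE mulnC exprM.
have E5 : geom P t * (t ^+ Q - 1) * b = t ^+ (P * Q) - 1.
  have t1 : t - 1 != 0 by apply: monic_neq0; apply: monic_Xn_sub_1.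
  apply: (mulIf t1); rewrite -(@binary_polyE P Q lam mu t) // -geomE -/b; ring.
have [c6 E6] : polydvd Z (t ^+ (P * Q) - 1).
  by exists (geom R 'X^(P * Q)); rewrite mulrC geomE /t -!exprM mulnC.
have EP : geom P 'X = c1 * Z + c2 * geom P t by rewrite -E1 -E2 subrK.
have EQ : 'X^Q - 1 = c3 * Z + (t ^+ Q - 1) * geom S (t ^+ Q).
  by rewrite -E3 -E4; ring.
exists ((c1 * (c3 * Z + (t ^+ Q - 1) * geom S (t ^+ Q)) + c2 * geom P t * c3) * b
   + c2 * geom S (t ^+ Q) * c6).
transitivity ((c1 * (c3 * Z + (t ^+ Q - 1) * geom S (t ^+ Q)) + c2 * geom P t * c3) * b * Z
   + c2 * geom S (t ^+ Q) * (geom P t * (t ^+ Q - 1) * b)).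
  by rewrite EP EQ; ring.
by rewrite E5 E6; ring.
Qed.

(** Multiplying the hypothesis by (X - 1)(X^RP - 1)(X^RQ - 1) gives the defining fraction, and
    division by a monic denominator recovers the exact quotient. *)
Lemma incl_excl_polyE P Q R lam mu F : (0 < P)%N -> (0 < Q)%N -> (0 < R)%N ->
  (mu * P + lam * Q = (P * Q).+1)%N -> (mu <= Q)%N -> (lam <= P)%N ->
  geom P 'X * ('X^Q - 1) * binary_poly P Q lam mu 'X^R = F * ('X^(P * Q) - 1) ->
  incl_excl_poly P Q R = F.
Proof.
move=> P_gt0 Q_gt0 R_gt0 bez le_mu le_lam EF; rewrite /incl_excl_poly.
have mon k : (0 < k)%N -> 'X^k - 1 \is @monic int by exact: monic_Xn_sub_1.
set den := (X in _ %/ X).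
have mon_den : den \is monic.
  by rewrite /den -['X - 1]/('X^1 - 1) !monicMl ?mon // muln_gt0 ?P_gt0 ?Q_gt0 ?R_gt0.
rewrite -[RHS](Pdiv.IdomainMonic.mulpK mon_den F); congr (_ %/ _).
have := @binary_polyE P Q lam mu 'X^R bez le_mu le_lam.
rewrite -!exprM => Eb.
transitivity ((geom P 'X * ('X^Q - 1) * binary_poly P Q lam mu 'X^R) *
  (('X - 1) * ('X^(R * P) - 1) * ('X^(R * Q) - 1))).
  transitivity (('X^P - 1) * ('X^Q - 1) * (('X^(R * (P * Q)) - 1) * ('X^R - 1) : {poly int})).
    by rewrite [(R * (P * Q))%N]mulnC; ring.
  by rewrite -Eb -(geomE P 'X); ring.
by rewrite EF /den [(Q * R)%N]mulnC; ring.
Qed.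

(** * Coefficients as numbers of representations of an exponent *)

Lemma coef_geom3 K M A al B be t :
  (geom K 'X^M * (geom A 'X^al * geom B 'X^be))`_t =
  \sum_(l < K) \sum_(x < A) \sum_(y < B) (t == M * l + (al * x + be * y))%N%:R.
Proof.
rewrite /geom mulr_suml coef_sum; apply: eq_bigr => l _.
rewrite mulr_suml mulr_sumr coef_sum; apply: eq_bigr => x _.
rewrite !mulr_sumr coef_sum; apply: eq_bigr => y _.
by rewrite -!exprM -!exprD coefXn.
Qed.

Lemma coef_geom3_eq0 K M A al B be t :
  (forall l x y, (x < A)%N -> (y < B)%N -> t <> (M * l + (al * x + be * y))%N) ->
  (geom K 'X^M * (geom A 'X^al * geom B 'X^be))`_t = 0.
Proof.
move=> H; rewrite coef_geom3 big1 // => l _; rewrite big1 // => x _.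
by rewrite big1 // => y _; case: eqP => // /H; case; exact: ltn_ord.
Qed.

Lemma coef_geom3_eq1 K M A al B be t l0 x0 y0 :
  (l0 < K)%N -> (x0 < A)%N -> (y0 < B)%N -> (0 < M)%N ->
  t = (M * l0 + (al * x0 + be * y0))%N ->
  (forall l x y, (x < A)%N -> (y < B)%N -> t = (M * l + (al * x + be * y))%N ->
     x = x0 /\ y = y0) ->
  (geom K 'X^M * (geom A 'X^al * geom B 'X^be))`_t = 1.
Proof.
move=> ltl ltx lty M_gt0 Et uniq; rewrite coef_geom3.
rewrite (bigD1 (Ordinal ltl)) //= (bigD1 (Ordinal ltx)) //= (bigD1 (Ordinal lty)) //=.
rewrite -Et eqxx !big1 ?addr0 // => [l nel|x nex|y ney].
- rewrite big1 // => x _; rewrite big1 // => y _; case: eqP => // Et'.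
  have [Ex Ey] := uniq _ _ _ (ltn_ord x) (ltn_ord y) Et'.
  case/eqP: nel; apply/val_inj => /=; move: Et'; rewrite Et Ex Ey => /addIn/eqP.
  by rewrite eqn_pmul2l // => /eqP.
- rewrite big1 // => y _; case: eqP => // Et'.
  have [Ex Ey] := uniq _ _ _ (ltn_ord x) (ltn_ord y) Et'.
  by case/eqP: nex; apply/val_inj.
case: eqP => // Et'; have [//|_ Ey] := uniq _ _ _ _ (ltn_ord y) Et'.
by case/eqP: ney; apply/val_inj.
Qed.

(** [G] replaces the power series b / (1 - X^PQ) by its first n + 1 blocks; the error starts at
    degree PQ (n + 1), beyond n. The bound P + Q <= n prevents truncated subtractions. *)
Lemma coef_incl_excl P Q F b n : (0 < P)%N -> (0 < Q)%N -> (P + Q <= n)%N ->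
  geom P 'X * ('X^Q - 1) * b = F * ('X^(P * Q) - 1) ->
  let G := geom n.+1 'X^(P * Q) * b in
  F`_n = \sum_(k < P) (G`_(n - k) - G`_(n - k - Q)).
Proof.
move=> P_gt0 Q_gt0 le_n EF G.
have EG : geom P 'X * (('X^Q - 1) * G) = F * 'X^(P * Q * n.+1) - F.
  transitivity (geom P 'X * ('X^Q - 1) * b * geom n.+1 'X^(P * Q)).
    by rewrite /G; ring.
  by rewrite EF -mulrA geomE -exprM mulrBr mulr1.
have lt_n : (n < P * Q * n.+1)%N by rewrite -[X in (X <= _)%N]mul1n leq_pmul2r // muln_gt0 P_gt0.
apply: oppr_inj; rewrite -[LHS]add0r.
have := congr1 (fun s : {poly int} => s`_n) EG.
rewrite coefB coefMXn lt_n => <-.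
rewrite /geom mulr_suml coef_sum -sumrN; apply: eq_bigr => k _.
have lt_k := ltn_ord k.
rewrite coefXnM ltnNge ltnW /=; last by lia.
rewrite mulrBl mul1r coefB coefXnM ltnNge.
have -> /= : (Q <= n - k)%N by lia.
by rewrite opprB.
Qed.

(** * Coefficients of G, and then of F, in the window below R lam Q *)

Section Window.

Variables P Q R lam mu d : nat.
Hypotheses (P_gt0 : (0 < P)%N) (Q_gt0 : (0 < Q)%N) (R_gt0 : (0 < R)%N).
Hypothesis bezout : (mu * P + lam * Q = (P * Q).+1)%N.
Hypothesis d_gt0 : (0 < d)%N.
Hypotheses (lam_gt0 : (0 < lam)%N) (lam_lt : (lam < P)%N).
Hypothesis RQ1 : R * Q = 1 %[mod P].
Hypothesis RPd1 : R * P * d = 1 %[mod Q].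
Hypothesis Q_large : (2 * d * P ^ 2 < Q)%N.

Lemma PQ_coprime : coprime P Q.
Proof.
have : coprime (R * P * d) Q by rewrite -coprime_modl RPd1 coprime_modl coprime1n.
by rewrite !coprimeMl => /andP[/andP[]].
Qed.

Lemma R_PQ_coprime : coprime R (P * Q).
Proof.
have : coprime (R * P * d) Q by rewrite -coprime_modl RPd1 coprime_modl coprime1n.
have : coprime (R * Q) P by rewrite -coprime_modl RQ1 coprime_modl coprime1n.
by rewrite !coprimeMl coprimeMr => /andP[-> _] /andP[/andP[-> _] _].
Qed.

(** As lam < P, Bezout gives mu P > Q. With its counterpart for Q - mu, this puts residues at most
    dP below mu, and those at least Q - dP at or above mu. *)
Lemma dP_lt_mu : (d * P < mu)%N.
Proof.
rewrite -(ltn_pmul2r P_gt0).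
have : (P * Q - lam * Q >= Q)%N by rewrite -mulnBl leq_pmull // subn_gt0.
by move: Q_large bezout; rewrite -mulnn; lia.
Qed.

Lemma mu_le_QdP : (mu <= Q - d * P)%N.
Proof.
have lamQ : (Q <= lam * Q)%N by rewrite leq_pmull.
have : (mu * P + d * P * P <= Q * P)%N.
  by move: Q_large bezout; rewrite -mulnn [(Q * P)%N]mulnC; lia.
by rewrite -mulnDl leq_pmul2r //; lia.
Qed.

Lemma mu_le_Q : (mu <= Q)%N.
Proof. exact: leq_trans mu_le_QdP (leq_subr _ _). Qed.

Lemma dt_mod l x y : (d * (P * Q * l + (R * P * x + R * Q * y)) = x %[mod Q])%N.
Proof.
have -> : (d * (P * Q * l + (R * P * x + R * Q * y)) =
   (d * P * l + d * R * y) * Q + R * P * d * x)%N by ring.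
by rewrite modnMDl -modnMml RPd1 modnMml mul1n.
Qed.

Lemma t_mod l x y : (P * Q * l + (R * P * x + R * Q * y) = y %[mod P])%N.
Proof.
have -> : (P * Q * l + (R * P * x + R * Q * y) =
   (Q * l + R * x) * P + R * Q * y)%N by ring.
by rewrite modnMDl -modnMml RQ1 modnMml mul1n.
Qed.

(** Both [d * R] and mu invert P modulo Q. Hence d times an exponent falls modulo Q in [0, mu) for
    the positive double sum and in [mu, Q) for the negative one. *)
Lemma dt_mod_shift l x y :
  (d * (P * Q * l + (R * P * x + R * Q * y) + R) = x + mu %[mod Q])%N.
Proof.
rewrite mulnDr -modnDml dt_mod modnDml -modnDmr; apply/eqP.
have -> : (d * R = mu %[mod Q])%N.
  rewrite -[in RHS](mul1n mu) -[in RHS]modnMml -RPd1 modnMml.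
  have -> : (R * P * d * mu = d * R * (mu * P))%N by ring.
  rewrite -[in RHS]modnMmr; have -> : (mu * P = 1 %[mod Q])%N.
    by rewrite -(modnMDl lam) addnC bezout -addn1 modnMDl.
  by rewrite modnMmr muln1.
by rewrite modnDmr.
Qed.

(** Positive monomials with x <= dP have exponents at most [lo]; negative ones with x + mu >= Q - dP
    have exponents at least [hi]. *)
Let lo := (R * (lam.-1 * Q + d * P * P))%N.
Let hi := (R * (lam * Q - d * P * P))%N.
Let G K := geom K 'X^(P * Q) * binary_poly P Q lam mu 'X^R.

Lemma coef_G K t :
  (G K)`_t = (geom K 'X^(P * Q) * (geom mu 'X^(R * P) * geom lam 'X^(R * Q)))`_t
  - (if (t < R)%N then 0 else
     (geom K 'X^(P * Q) * (geom (Q - mu) 'X^(R * P) * geom (P - lam) 'X^(R * Q)))`_(t - R)).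
Proof.
rewrite /G /binary_poly -!exprM mulrBr coefB; congr (_ - _).
by rewrite mulrCA coefXnM.
Qed.

Lemma coef_G_low K t : (lo <= t)%N -> (t < K)%N -> (t %% Q < P)%N ->
  (G K)`_t = (t %% P < lam)%N%:R.
Proof.
move=> lo_t lt_K t_low; set x0 := (d * (t %% Q))%N.
have le_x0 : (x0 <= d * P)%N by rewrite leq_mul2l ltnW ?orbT.
have lt_x0 : (x0 < mu)%N := leq_ltn_trans le_x0 dP_lt_mu.
have dt : (d * t = x0 %[mod Q])%N by rewrite modnMmr.
have modx0 : (x0 %% Q = x0)%N by rewrite modn_small // (leq_trans lt_x0 mu_le_Q).
have uniq l x y : (x < mu)%N -> (y < lam)%N ->
    t = (P * Q * l + (R * P * x + R * Q * y))%N -> x = x0 /\ y = (t %% P)%N.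
  move=> ltx lty Et; split; last by rewrite Et t_mod modn_small // (ltn_trans lty).
  by rewrite -modx0 -dt Et dt_mod modn_small // (leq_trans ltx mu_le_Q).
(* A negative term would need x + mu = x0, whereas x0 < mu. *)
rewrite coef_G; set c2 := (X in _ - X); have -> : c2 = 0.
  rewrite /c2; case: ltnP => // le_R; apply: coef_geom3_eq0 => l x y ltx lty Et.
  have lt_xmu : (x + mu < Q)%N by rewrite addnC -ltn_subRL.
  have := dt; rewrite -[X in (d * X)%N](subnK le_R) Et dt_mod_shift modx0 modn_small // => Ex.
  by move: lt_x0; rewrite -Ex ltnNge leq_addl.
rewrite subr0; case: ltnP => [lt_lam|le_lam]; last first.
  apply: coef_geom3_eq0 => l x y ltx lty Et.
  by have [_ Ey] := uniq _ _ _ ltx lty Et; move: le_lam; rewrite -Ey leqNgt lty.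
set w := (R * P * x0 + R * Q * (t %% P))%N.
have le_w : (w <= t)%N.
  apply: leq_trans lo_t; rewrite /w /lo mulnDr addnC leq_add //.
    rewrite -mulnA leq_mul2l [(_ * Q)%N]mulnC leq_mul2l.
    by apply/orP; right; apply/orP; right; rewrite -ltnS prednK.
  by rewrite -mulnA leq_mul2l [(P * _)%N]mulnC leq_mul2r le_x0 !orbT.
(* The only candidate monomial has exponent [w <= t]; a congruence modulo PQ then yields the missing
   multiple [l0]. *)
have : (t == w %[mod P * Q])%N.
  rewrite chinese_remainder ?PQ_coprime //; apply/andP; split; apply/eqP.
    by have := t_mod 0 x0 (t %% P); rewrite muln0 add0n modn_mod -/w.
  rewrite /w /x0.
  have -> : (R * P * (d * (t %% Q)) + R * Q * (t %% P) =
     R * (t %% P) * Q + R * P * d * (t %% Q))%N by ring.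
  by rewrite modnMDl -modnMml RPd1 modnMml mul1n modn_mod.
rewrite eqn_mod_dvd // => /dvdnP[l0 El0].
have Et : t = (P * Q * l0 + w)%N by rewrite mulnC -El0 subnK.
apply: (coef_geom3_eq1 _ lt_x0 lt_lam _ Et uniq); last by rewrite muln_gt0 P_gt0.
apply: leq_ltn_trans lt_K; rewrite Et; apply: leq_trans (leq_addr _ _).
by rewrite leq_pmull // muln_gt0 P_gt0.
Qed.

(** Here d t is Q - df modulo Q with 0 < f <= P. This is at least mu, excluding positive terms, and
    a negative term would have exponent at least [hi]. *)
Lemma coef_G_high K t : (t < hi)%N -> (Q - P <= t %% Q)%N -> (G K)`_t = 0.
Proof.
move=> t_hi t_high; set f := (Q - t %% Q)%N.
have lt_tQ : (t %% Q < Q)%N by rewrite ltn_pmod.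
have [f_gt0 f_le] : (0 < f)%N /\ (f <= P)%N by rewrite /f subn_gt0 leq_subLR addnC -leq_subLR.
have le_df : (d * f <= d * P)%N by rewrite leq_mul2l f_le orbT.
have dP_lt : (d * P < Q)%N := leq_trans dP_lt_mu mu_le_Q.
have dt x : (x < Q)%N -> (d * t = x %[mod Q])%N -> (x + d * f)%N = 0 %[mod Q].
  move=> ltx E; rewrite -modnDml -E -[(d * t %% Q)%N]modnMmr modnDml -mulnDr /f.
  by rewrite (subnKC (ltnW lt_tQ)) modnMl mod0n.
have x_eq x : (x < Q)%N -> (d * t = x %[mod Q])%N -> x = (Q - d * f)%N.
  have df_gt0 : (0 < d * f)%N by rewrite muln_gt0 d_gt0.
  (* x + df is a multiple of Q strictly between 0 and 2Q. *)
  move=> ltx /(dt _ ltx) /eqP; rewrite mod0n => /dvdnP[[|[|k]]]; rewrite ?mulSn;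
    move: ltx df_gt0 le_df dP_lt; clear; lia.
rewrite coef_G coef_geom3_eq0 ?sub0r => [|l x y ltx lty Et]; last first.
  have := x_eq x (leq_trans ltx mu_le_Q); rewrite Et dt_mod => /(_ erefl).
  by have := mu_le_QdP; move: ltx le_df; clear; lia.
case: ltnP => [|le_R]; first by rewrite oppr0.
rewrite coef_geom3_eq0 ?oppr0 // => l x y ltx lty Et.
have lt_xmu : (x + mu < Q)%N by rewrite addnC -ltn_subRL.
have : (x + mu = Q - d * f)%N.
  by apply: x_eq => //; rewrite -(subnK le_R) Et dt_mod_shift.
have Et' : (t = P * Q * l + (R * P * x + R * Q * y) + R)%N by rewrite -Et subnK.
move=> Ex; move: t_hi; rewrite /hi ltnNge => /negP; apply.
have : (R * (x * P + 1) <= t)%N by rewrite Et'; clear; nia.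
apply: leq_trans; rewrite leq_mul2l; apply/orP; right.
have Emu : ((x + mu + d * f) * P = Q * P)%N by rewrite Ex subnK // ltnW // (leq_ltn_trans le_df).
have : (d * f * P <= d * P * P)%N by rewrite leq_mul2r le_df orbT.
by move: Emu bezout; rewrite !mulnDl [(Q * P)%N]mulnC; clear; lia.
Qed.

(** For k < m the residue of n - k modulo Q is m - 1 - k < P; for m <= k < P it wraps around to at
    least Q - P, and both G-values vanish. Using [n.+1] covers m = 0. *)
Lemma coef_window F n m : (lo + P + Q <= n)%N -> (n < hi)%N -> (m <= P)%N ->
  n.+1 = m %[mod Q] ->
  geom P 'X * ('X^Q - 1) * binary_poly P Q lam mu 'X^R = F * ('X^(P * Q) - 1) ->
  F`_n = \sum_(k < m) ((((n - k) %% P < lam)%N)%:R - ((n - k - Q) %% P < lam)%N%:R).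
Proof.
move=> lo_n n_hi le_m En EF.
rewrite (coef_incl_excl _ _ _ EF) //; last by apply: leq_trans lo_n; lia.
have PQ : (P < Q)%N.
  apply: leq_ltn_trans Q_large; rewrite -mulnn mulnA.
  by rewrite leq_pmull // !muln_gt0 d_gt0.
have [j Ej] : exists j, (n.+1 = j * Q + m)%N.
  exists (n.+1 %/ Q)%N; rewrite {1}(divn_eq n.+1 Q) En modn_small //.
  exact: leq_ltn_trans PQ.
have le_n : (P + Q <= n)%N by apply: leq_trans lo_n; rewrite -addnA leq_addl.
rewrite (big_ord_widen P (fun k => (((n - k) %% P < lam)%N)%:R
  - ((n - k - Q) %% P < lam)%N%:R) le_m) [RHS]big_mkcond /=.
apply: eq_bigr => k _; have lt_k := ltn_ord k.
have le_Q : (Q <= n - k)%N by move: lt_k le_n; clear; lia.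
have modQ : ((n - k - Q) %% Q = (n - k) %% Q)%N by rewrite -[in RHS](subnK le_Q) modnDr.
have lo_k : (lo <= n - k - Q)%N by move: lt_k lo_n; clear; lia.
have k_hi : (n - k < hi)%N := leq_ltn_trans (leq_subr _ _) n_hi.
case: ltnP => [lt_km|le_mk].
  have low : ((n - k) %% Q < P)%N.
    have -> : (n - k = j * Q + (m - k.+1))%N by move: Ej lt_km; clear; lia.
    rewrite modnMDl; apply: leq_ltn_trans (leq_mod _ _) _.
    by move: lt_km le_m; clear; lia.
  rewrite !coef_G_low ?modQ ?ltnS // ?(leq_trans lo_k) ?leq_subr //.
  exact: leq_trans (leq_subr _ _) (leq_subr _ _).
have high : (Q - P <= (n - k) %% Q)%N.
  have [i Ei] : exists i, (n - k = i * Q + (Q + m - k.+1))%N.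
    case: j Ej => [|i] Ej; first by move: Ej le_n le_m P_gt0 Q_gt0; clear; lia.
    by exists i; move: Ej lt_k le_mk PQ; rewrite mulSn; clear; lia.
  rewrite Ei modnMDl modn_small; first by move: lt_k PQ; clear; lia.
  by move: le_mk PQ lt_k; clear; lia.
rewrite !coef_G_high ?modQ ?subrr //.
exact: leq_ltn_trans (leq_subr _ _) k_hi.
Qed.

End Window.

(** * Every integer of absolute value below h as a coefficient *)

Lemma incl_excl_coef_range P Q R h d c (z : int) :
  (0 < d)%N -> (1 < h)%N -> (2 * h <= P)%N -> (Q + h = c * P + 1)%N ->
  (h.+1 * Q = 1 %[mod P])%N -> (R * Q = 1 %[mod P])%N -> (R * P * d = 1 %[mod Q])%N ->
  (2 * d * P ^ 2 < Q)%N -> (4 * P * Q <= R)%N -> (`|z| < h)%N ->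
  coef_set P Q R z.
Proof.
move=> d_gt0 h_gt1 le_h EQ lamQ1 RQ1 RPd1 Q_large R_large z_lt.
have P_gt0 : (0 < P)%N by move: h_gt1 le_h; clear; lia.
have Q_gt0 : (0 < Q)%N by apply: leq_ltn_trans Q_large.
have PQ_gt0 : (0 < P * Q)%N by rewrite muln_gt0 P_gt0.
have R_gt0 : (0 < R)%N by apply: leq_trans R_large; rewrite -mulnA muln_gt0.
have lam_lt : (h.+1 < P)%N by move: h_gt1 le_h; clear; lia.
have [mu bez] : exists mu, (mu * P + h.+1 * Q = (P * Q).+1)%N.
  have /dvdnP[e Ee] : (P %| h.+1 * Q - 1)%N by rewrite -eqn_mod_dvd ?lamQ1 // muln_gt0.
  have e_le : (e <= Q)%N.
    rewrite -(leq_pmul2r P_gt0) -Ee leq_subLR mulnC.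
    by apply: leq_trans (leqnSn _); rewrite leq_mul2l ltnW // orbT.
  exists (Q - e)%N; rewrite mulnBl -Ee [(Q * P)%N]mulnC.
  have : (0 < h.+1 * Q)%N by rewrite muln_gt0.
  have : (h.+1 * Q <= P * Q)%N by rewrite leq_mul2r ltnW ?orbT.
  by clear; lia.
have mu_le : (mu <= Q)%N.
  exact: (mu_le_Q P_gt0 Q_gt0 R_gt0 bez d_gt0 (ltn0Sn h) lam_lt RQ1 RPd1 Q_large).
have cop := R_PQ_coprime RQ1 RPd1.
have [F EF] := incl_excl_quotient P_gt0 Q_gt0 R_gt0 cop bez mu_le (ltnW lam_lt).
have EincF := incl_excl_polyE P_gt0 Q_gt0 R_gt0 bez mu_le (ltnW lam_lt) EF.
set lo := (R * (h.+1.-1 * Q + d * P * P))%N.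
set hi := (R * (h.+1 * Q - d * P * P))%N.
(* The window has length R (Q - 2dP^2) >= R >= 4PQ, enough for a margin P + Q and two full periods
   PQ. *)
have win : (lo + P + Q + P * Q + P * Q <= hi)%N.
  have -> : (hi = lo + R * (Q - 2 * d * P ^ 2))%N.
    rewrite /hi /lo -mulnDr; congr (_ * _)%N; rewrite /= mulSn -mulnn.
    by move: Q_large; rewrite -mulnn; clear; lia.
  rewrite -!addnA leq_add2l; apply: (@leq_trans R); last first.
    by rewrite leq_pmulr // subn_gt0.
  apply: leq_trans R_large.
  have : (P <= P * Q)%N by rewrite leq_pmulr.
  have : (Q <= P * Q)%N by rewrite leq_pmull.
  by rewrite -mulnA; clear; lia.
have val (s : bool) (m base : nat) : (m < h)%N -> (lo + P + Q <= base)%N ->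
    (base + P * Q <= hi)%N ->
    exists2 n, (base <= n < base + P * Q)%N & F`_n = (-1) ^+ s * m%:R.
  move=> lt_m lo_b b_hi.
  (* Residue -1 modulo P yields negative values and residue h positive ones; adding Q before the
     predecessor handles m = 0. *)
  have [n [n_ge n_lt nP nQ]] := crt_window (if s then P.-1 else h) (m + Q).-1 base
    P_gt0 Q_gt0 (PQ_coprime RPd1).
  exists n; first by rewrite n_ge.
  have nQ' : (n.+1 = m %[mod Q])%N.
    rewrite -addn1 -modnDml nQ modnDml addn1 prednK ?modnDr //.
    by rewrite addn_gt0 Q_gt0 orbT.
  have le_mP : (m <= P)%N by move: lt_m le_h; clear; lia.
  rewrite (coef_window P_gt0 Q_gt0 R_gt0 bez d_gt0 (ltn0Sn h) lam_lt RQ1 RPd1 Q_large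
    (leq_trans lo_b n_ge) (leq_trans n_lt b_hi) le_mP nQ' EF).
  have PQ_le : (P + Q <= n)%N.
    by apply: leq_trans n_ge; apply: leq_trans lo_b; rewrite -addnA leq_addl.
  transitivity (\sum_(k < m) (-1) ^+ s : int); last first.
    by rewrite sumr_const card_ord mulr_natr.
  apply: eq_bigr => k _.
  have lt_k : (k < m)%N := ltn_ord k.
  have [i Ei] : exists i, n = (i * P + if s then P.-1 else h)%N.
    exists (n %/ P)%N; rewrite {1}(divn_eq n P) nP modn_small //.
    by case: (s); move: lam_lt; clear; lia.
  (* Since Q is 1 - h modulo P, subtracting Q adds h - 1. The bound k <= h - 2 keeps h - k - 2
     nonnegative in the first case and 2h - k - 1 above h in the second. *)
  case: s {nP} Ei => Ei.
    have -> : ((n - k) %% P = P - k.+1)%N.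
      apply: (@modn_eq_of_shift _ _ 0 i); first by move: P_gt0; clear; lia.
      by move: Ei P_gt0 lt_k lt_m le_h; clear; lia.
    have -> : ((n - k - Q) %% P = h - k.+2)%N.
      apply: (@modn_eq_of_shift _ _ c i.+1); first by move: h_gt1 le_h; clear; lia.
      by move: Ei P_gt0 lt_k lt_m le_h EQ PQ_le; clear; lia.
    have -> : (P - k.+1 < h.+1)%N = false by move: lt_k lt_m le_h; clear; lia.
    have -> : (h - k.+2 < h.+1)%N by move: h_gt1; clear; lia.
    by rewrite sub0r.
  have lt_hP : (h < P)%N := ltnW lam_lt.
  have -> : ((n - k) %% P = h - k)%N.
    apply: (@modn_eq_of_shift _ _ 0 i); first by move: lt_hP; clear; lia.
    by move: Ei lt_k lt_m; clear; lia.
  have -> : ((n - k - Q) %% P = 2 * h - k.+1)%N.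
    apply: (@modn_eq_of_shift _ _ c i); first by move: P_gt0 le_h; clear; lia.
    by move: Ei lt_k lt_m le_h EQ PQ_le; clear; lia.
  have -> : (2 * h - k.+1 < h.+1)%N = false by move: lt_k lt_m; clear; lia.
  have -> : (h - k < h.+1)%N by clear; lia.
  by rewrite subr0.
have mem n : F`_n != 0 -> (n < size F)%N.
  by rewrite ltnNge; apply: contra => le_n; rewrite nth_default.
rewrite /coef_set /= EincF.
(* A zero counts only within the degree, so a coefficient 1 is located in the period after it. *)
have [z0|z_neq0] := eqVneq z 0.
  have [|||n0 n0_win F0] := val false 0%N (lo + P + Q)%N => //.
  - exact: ltnW.
  - by apply: leq_trans win; rewrite leq_addr.
  have [|||n1 n1_win F1] := val false 1%N (lo + P + Q + P * Q)%N => //.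
    by rewrite leq_addr.
  have lt_n1 : (n1 < size F)%N by apply: mem; rewrite F1.
  rewrite z0 -[0](_ : F`_n0 = 0); last by rewrite F0 mulr0.
  apply: mem_nth; apply: leq_ltn_trans lt_n1.
  case/andP: n0_win => _ /ltnW le0; case/andP: n1_win => le1 _; exact: leq_trans le1.
have [|||n n_win Fn] := val (z < 0) `|z|%N (lo + P + Q)%N => //.
  by apply: leq_trans win; rewrite leq_addr.
have Fz : F`_n = z by rewrite Fn natz -intEsign.
by rewrite -Fz; apply: mem_nth; apply: mem; rewrite Fz.
Qed.

(** * Assembling the exponents and comparing h with P / 4 *)

Theorem theorem1 (R : realType) (p q r : nat)
    (p_prime : prime p) (q_prime : prime q) (r_prime : prime r)
    (p_neq_q : p <> q) (q_neq_r : q <> r) (r_neq_p : r <> p)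
    (eps : R) (eps_gt0 : 0 < eps) :
  exists a_eps : nat, forall a : nat, (a_eps <= a)%N ->
    exists b c : nat,
      [/\ (2 < p ^ a)%N, (2 < q ^ b)%N, (2 < r ^ c)%N
        & [set n : int | `|n|%:~R <= (1 / 4 - eps) * (p ^ a)%N%:R]
            `<=` coef_set (p ^ a) (q ^ b) (r ^ c)].
Proof.
have [k Hk] := prime_power_residues p_prime q_prime r_prime p_neq_q q_neq_r r_neq_p.
(* This gives k <= a - 1, so [p ^ k] divides h, and a > 3, so P >= 12. *)
exists (k + 4)%N => a le_a.
have p_gt0 := prime_gt0 p_prime.
have a_gt3 : (3 < a)%N by apply: leq_trans le_a; rewrite leq_addl.
have a_gt0 : (0 < a)%N by apply: leq_trans a_gt3.
have [] := half_power_bounds p_prime a_gt3.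
set P := (p ^ a)%N; set h := (p %/ 2 * _)%N => le_2h ge_3h P_ge12.
have dvd_kh : (p ^ k %| h)%N.
  rewrite /h; apply: dvdn_mull; rewrite dvdn_exp2l //.
  by move: le_a; clear; lia.
have dvd_kP : (p ^ k %| P)%N by rewrite /P dvdn_exp2l // (leq_trans _ le_a) // leq_addr.
have dvd_Phh : (P %| h * h)%N.
  rewrite /h /P mulnACA -expnD dvdn_mull // dvdn_exp2l //.
  by move: a_gt3; clear; lia.
(* The prescribed residues modulo P are 1 - h for Q and 1 + h for R; they are mutually inverse
   because P divides h^2. *)
have [||b [c [d [d_gt0 Qu Rv RPd [Q_large R_large]]]]] := Hk a (P - h).+1 h.+1.
- have /dvdnP[e ->] : (p ^ k %| P - h)%N by exact: (dvdn_sub dvd_kP dvd_kh).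
  by rewrite -addn1 modnMDl.
- by case/dvdnP: dvd_kh => e ->; rewrite -addn1 modnMDl.
rewrite -/P in Qu Rv RPd Q_large R_large.
set Q := (q ^ b)%N in Qu RPd Q_large R_large *.
set S := (r ^ c)%N in Rv RPd R_large *.
have Qh : (Q + h = 1 %[mod P])%N.
  rewrite -modnDml Qu modnDml addSn subnK; first by rewrite -add1n modnDr.
  by move: le_2h; clear; lia.
have Q_gt : (P < Q)%N.
  apply: leq_ltn_trans Q_large; rewrite -mulnn mulnA leq_pmull //.
  by rewrite !muln_gt0 d_gt0 expn_gt0 p_gt0.
have lamQ : (h.+1 * Q = 1 %[mod P])%N.
  rewrite -modnMmr Qu modnMmr.
  have -> : (h.+1 * (P - h).+1 = h.+1 * P + 1 - h * h)%N.
    by move: le_2h; clear; nia.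
  case/dvdnP: dvd_Phh => e Ee; rewrite Ee.
  have le_e : (e <= h)%N.
    rewrite -(@leq_pmul2r P) ?expn_gt0 ?p_gt0 // -Ee leq_mul2l.
    by apply/orP; right; move: le_2h; clear; lia.
  have -> : (h.+1 * P + 1 - e * P = (h.+1 - e) * P + 1)%N.
    by rewrite mulnBl; move: (leq_mul le_e (leqnn P)); clear; nia.
  by rewrite modnMDl.
have SQ : (S * Q = 1 %[mod P])%N by rewrite -modnMml Rv modnMml.
exists b, c; split.
- exact: leq_trans P_ge12.
- by apply: leq_trans Q_gt; move: P_ge12; clear; lia.
- apply: leq_trans R_large; rewrite -mulnA.
  have : (P <= P * Q)%N by rewrite leq_pmulr // (leq_ltn_trans _ Q_gt).
  by move: P_ge12; clear; lia.
move=> n /= n_le.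
have {}n_le : (4 * `|n| <= P)%N.
  have : `|n|%:~R <= 1 / 4 * P%:R :> R.
    apply: le_trans n_le _; rewrite ler_wpM2r // gerBl; exact: ltW.
  have -> : (`|n|%:~R = `|n|%N%:R :> R) by rewrite -abszE.
  by rewrite -(ler_nat R) natrM; lra.
have [e Ee] : exists e, (Q + h = e * P + 1)%N.
  exists ((Q + h) %/ P)%N; rewrite {1}(divn_eq (Q + h) P) Qh modn_small //.
  exact: leq_trans P_ge12.
(* From 12 <= P <= 3h follows h > 1, and 4|n| <= P <= 3h gives |n| < h. *)
apply: (incl_excl_coef_range d_gt0 _ le_2h Ee lamQ SQ RPd Q_large R_large).
  by move: ge_3h P_ge12; clear; lia.
by move: n_le ge_3h P_ge12; clear; lia.
Qed.
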